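(* For integers $n\ge0$ and $j\ge 0$, let $P(j,n)$ be the number of partitions of $n$ whose smallest part $j$ appears exactly $j$ times and all of whose other parts are distinct (and larger than $j$), where $P(0,n)$ is the number of partitions of $n$ into distinct parts. Then \[ \sum_{j=0}^{n}(-1)^jP(j,n)=b(n), \] where $b(n)$ is the number of non-Rascoe partitions of $n$.
   Context: A non-Rascoe partition of a positive integer $n$ is a partition of $n$ into distinct parts in which the number of parts is not itself a part; the empty partition is counted as the unique non-Rascoe partition of $0$, so $b(0)=1$. *)

(* Defs.v *)
From mathcomp Require Import all_boot.

Set Implicit Arguments.
Unset Strict Implicit.
Unset Printing Implicit Defensive.

(* Partitions are weakly decreasing sequences of positive parts. *)
Definition is_partition (n : nat) (s : seq nat) : bool :=
  [&& sorted geq s, 0 \notin s & sumn s == n].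

(* A partition of n has at most n parts, each at most n, so all of them are
   found in the finite type n.-bseq 'I_n.+1; see partition_bseq below. *)
Definition num_partitions (n : nat) (p : pred (seq nat)) : nat :=
  #|[set t : n.-bseq 'I_n.+1 |
      is_partition n (map val t) && p (map val t)]|.

Lemma partition_bseq (n : nat) (s : seq nat) :
  is_partition n s -> exists! t : n.-bseq 'I_n.+1, map val t = s.
Proof.
case/and3P=> _ s_gt0 /eqP <-{n}.
have sz_s : size s <= sumn s.
  elim: s s_gt0 => //= x s IHs; rewrite in_cons negb_or eq_sym -lt0n.
  by case/andP=> x_gt0 /IHs le_s; rewrite -add1n leq_add.
have le_s x : x \in s -> x < (sumn s).+1.
  rewrite ltnS; elim: s {s_gt0 sz_s} => //= y s IHs; rewrite in_cons.
  by case/predU1P=> [->|/IHs/leq_trans-> //]; rewrite ?leq_addr ?leq_addl.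
have map_s : map val (map (@inord (sumn s)) s) = s.
  by rewrite -map_comp map_id_in // => x /le_s /inordK.
have sz_t : size (map (@inord (sumn s)) s) <= sumn s by rewrite size_map.
exists (Bseq sz_t); split=> // t eq_t; apply/val_inj/(inj_map val_inj).
by rewrite [LHS]map_s eq_t.
Qed.

Definition smallest_part (j : nat) (s : seq nat) : bool :=
  (j \in s) && all (leq j) s.

Definition P (j n : nat) : nat :=
  if j is 0 then num_partitions n uniq
  else num_partitions n (fun s =>
    [&& smallest_part j s, count_mem j s == j & uniq [seq x <- s | x != j]]).

Definition non_Rascoe (s : seq nat) : bool := uniq s && (size s \notin s).

Definition b (n : nat) : nat := num_partitions n non_Rascoe.

(* Main.v *)
(** Let [d l N] count the partitions of [N] into [l] distinct parts. Deleting
    the part [m] from a distinct partition with [l + 1] parts, one of which is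
    [m], leaves a distinct partition with [l] parts avoiding [m]; iterating, the
    distinct partitions of [n] with [m] parts, none equal to [m], number
    [\sum_k (-1)^k d (m - k) (n - k m)].  Adding [k] to each of the [m - k]
    parts of a distinct partition of [n - k m] and appending [k] copies of [k]
    gives the partitions with [m] parts counted by [P k n]; sum over [m]. *)

Require Import Defs.
From mathcomp Require Import all_boot all_order all_algebra.
From mathcomp Require Import zify ring.

Set Implicit Arguments.
Unset Strict Implicit.
Unset Printing Implicit Defensive.

Import GRing.Theory.

Lemma eq_num_partitions n (p q : pred (seq nat)) :
  (forall s, is_partition n s -> p s = q s) ->
  num_partitions n p = num_partitions n q.
Proof.
move=> eq_pq; apply: eq_card => t; rewrite !inE.
by case: (boolP (is_partition _ _)) => // /eq_pq->.
Qed.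

Lemma num_partitions0 n (p : pred (seq nat)) :
  (forall s, is_partition n s -> ~~ p s) -> num_partitions n p = 0.
Proof.
move=> Np; apply: eq_card0 => t; rewrite !inE.
by case: (boolP (is_partition _ _)) => // /Np /negbTE->.
Qed.

Lemma num_partitionsID n (p q : pred (seq nat)) :
  num_partitions n p = num_partitions n (fun s => p s && q s)
                     + num_partitions n (fun s => p s && ~~ q s).
Proof.
rewrite -[LHS](cardsID [set t : n.-bseq 'I_n.+1 | q (map val t)]).
by congr (_ + _); apply: eq_card => t; rewrite !inE -!andbA // andbC -!andbA.
Qed.

Lemma num_partitions_size n (p : pred (seq nat)) :
  num_partitions n p =
  \sum_(m < n.+1) num_partitions n (fun s => p s && (size s == m)).
Proof.
rewrite {1}/num_partitions -sum1dep_card.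
rewrite (partition_big (fun t : n.-bseq 'I_n.+1 => inord (size t) : 'I_n.+1)
  xpredT) //=.
apply: eq_bigr => m _; rewrite sum1dep_card; apply: eq_card => t.
by rewrite !inE size_map -val_eqE /= inordK ?ltnS ?size_bseq // andbA.
Qed.

(* [f] is only required to be injective on multisets, and need not preserve
   sortedness. *)
Lemma leq_num_partitions n n' (p p' : pred (seq nat)) (f : seq nat -> seq nat) :
  (forall s t, perm_eq s t -> p' s = p' t) ->
  (forall s, is_partition n s -> p s ->
     [/\ 0 \notin f s, sumn (f s) = n' & p' (f s)]) ->
  (forall s t, is_partition n s -> is_partition n t -> p s -> p t ->
     perm_eq (f s) (f t) -> perm_eq s t) ->
  num_partitions n p <= num_partitions n' p'.
Proof.
move=> p'_perm f_part f_inj.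
have geq_tr : transitive geq by move=> x y z; rewrite /geq /=; lia.
have geq_as : antisymmetric geq by move=> x y; rewrite /geq /=; lia.
have geq_tot : total geq by move=> x y; rewrite /geq /=; lia.
have sort_part s : is_partition n s -> p s ->
    is_partition n' (sort geq (f s)) && p' (sort geq (f s)).
  move=> s_n /(f_part s s_n)[f_gt0 f_sum p'f].
  rewrite /is_partition sort_sorted // mem_sort f_gt0.
  rewrite (perm_sumn (permEl (perm_sort _ _))) f_sum eqxx.
  by rewrite (p'_perm _ _ (permEl (perm_sort _ _))).
(* [insub_bseq] and [inord] could return defaults; [gE] excludes this through [partition_bseq],
   since the sorted image is a partition of [n']. *)
pose g (t : n.-bseq 'I_n.+1) : n'.-bseq 'I_n'.+1 :=
  insub_bseq n' (map inord (sort geq (f (map val t)))).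
have gE (t : n.-bseq 'I_n.+1) : is_partition n (map val t) -> p (map val t) ->
    map val (g t) = sort geq (f (map val t)).
  move=> t_n pt; have /andP[ft_n _] := sort_part _ t_n pt.
  have [u [def_u _]] := partition_bseq ft_n.
  rewrite /g -def_u -map_comp map_id_in; last by move=> x _; apply: inord_val.
  by rewrite insubdK //; apply: size_bseq.
rewrite /num_partitions -(@card_in_imset _ _ g) => [|s t].
  apply/subset_leq_card/subsetP => _ /imsetP[t + ->]; rewrite !inE => /andP[t_n pt].
  by rewrite gE //; apply: sort_part.
rewrite !inE => /andP[s_n ps] /andP[t_n pt] eq_g.
apply/val_inj/(inj_map val_inj); case/and3P: (s_n) (t_n) => s_srt _ _ /and3P[t_srt _ _].
apply: (sorted_eq geq_tr geq_as) => //; apply: f_inj => //.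
by apply/(perm_sortP geq_tot geq_tr geq_as); rewrite -!gE // eq_g.
Qed.

Definition num_distinct (l n : nat) : nat :=
  num_partitions n (fun s => uniq s && (size s == l)).

(** The avoided part [m] and the size [l] are independent, so that induction on [l] can keep [m]
    fixed; the theorem uses [l = m]. *)
Definition num_distinct_avoiding (m l n : nat) : nat :=
  num_partitions n (fun s => [&& uniq s, size s == l & m \notin s]).

(** [rem m] and [cons m] are inverse up to order, giving both inequalities. The guard [m <= n] keeps
    the truncated [n - m] from counting partitions of 0. *)
Lemma num_distinct_mem m l n : 0 < m ->
  num_partitions n (fun s => [&& uniq s, size s == l.+1 & m \in s]) =
  if m <= n then num_distinct_avoiding m l (n - m) else 0.
Proof.
move=> m_gt0.
have rem_sum s : m \in s -> sumn s = m + sumn (rem m s).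
  by move=> /perm_to_rem/perm_sumn.
case: ifP => [le_mn | gt_mn]; last first.
  apply: num_partitions0 => s /and3P[_ _ /eqP sum_s].
  apply/negP => /and3P[_ _ /rem_sum]; lia.
apply/eqP; rewrite eqn_leq; apply/andP; split.
  apply: (@leq_num_partitions _ _ _ _ (rem m)).
  - by move=> s t st; rewrite (perm_uniq st) (perm_size st) (perm_mem st).
  - move=> s /and3P[_ s_gt0 /eqP sum_s] /and3P[s_uniq /eqP sz_s ms].
    rewrite rem_uniq // mem_rem_uniqF // size_rem // sz_s eqxx; split=> //.
      by apply: contra s_gt0 => /mem_rem.
    by have := rem_sum s ms; lia.
  move=> s t _ _ /and3P[_ _ ms] /and3P[_ _ mt] st.
  rewrite (permPl (perm_to_rem ms)) (permPr (perm_to_rem mt)).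
  by rewrite perm_cons.
apply: (@leq_num_partitions _ _ _ _ (cons m)).
- by move=> s t st; rewrite (perm_uniq st) (perm_size st) (perm_mem st).
- move=> s /and3P[_ s_gt0 /eqP sum_s] /and3P[s_uniq /eqP sz_s ms].
  rewrite /= sum_s sz_s ms s_uniq eqxx !in_cons eqxx negb_or s_gt0.
  by split=> //; lia.
by move=> s t _ _ _ _; rewrite perm_cons.
Qed.

Lemma P_size_term k m n : 0 < k ->
  num_partitions n (fun s => [&& smallest_part k s, count_mem k s == k &
    uniq [seq x <- s | x != k]] && (size s == m)) =
  if (k <= m) && (k * m <= n) then num_distinct (m - k) (n - k * m) else 0.
Proof.
move=> k_gt0.
(* Up to order, [f] is inverted by adding [k] to every part and appending [k] copies of [k]. With
   [m] parts in total, this adds [k * (m - k) + k * k = k * m] to the sum. *)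
pose f s := [seq x - k | x <- s & x != k].
have fK s : all (leq k) s -> count_mem k s = k ->
    perm_eq s (map (addn k) (f s) ++ nseq k k).
  move=> /allP s_ge s_k; rewrite -map_comp map_id_in => [|x]; last first.
    by rewrite mem_filter => /andP[_ /s_ge] /=; lia.
  have /all_pred1P := filter_all (pred1 k) s.
  rewrite size_filter s_k => <-.
  by rewrite perm_sym perm_catC (permEl (perm_filterC (pred1 k) s)).
have sum_addk s : sumn (map (addn k) s) = k * size s + sumn s.
  by elim: s => [|x s IHs] /=; rewrite ?IHs; lia.
have sz_sum s : all (leq k) s -> count_mem k s = k ->
    size s = size (f s) + k /\ sumn s = k * size s + sumn (f s).
  move=> s_ge s_k; have s_f := fK s s_ge s_k.
  have sz_s : size s = size (f s) + k.
    by rewrite (perm_size s_f) size_cat size_map size_nseq.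
  split=> //; rewrite (perm_sumn s_f) sumn_cat sum_addk sumn_nseq sz_s; lia.
case: ifP => [/andP[le_km le_kmn] | out]; last first.
  apply: num_partitions0 => s /and3P[_ _ /eqP sum_s].
  apply/negP => /andP[/and3P[/andP[_ s_ge] /eqP s_k _] /eqP sz_s].
  by have [] := sz_sum s s_ge s_k; move: out; rewrite sum_s sz_s; lia.
apply/eqP; rewrite eqn_leq; apply/andP; split.
  apply: (@leq_num_partitions _ _ _ _ f).
  - by move=> s t st; rewrite (perm_uniq st) (perm_size st).
  - move=> s /and3P[_ s_gt0 /eqP sum_s].
    move=> /andP[/and3P[/andP[_ s_ge] /eqP s_k s_uniq] /eqP sz_s].
    have [szE sumE] := sz_sum s s_ge s_k.
    have f_ge x : x \in [seq x <- s | x != k] -> k < x.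
      by rewrite mem_filter => /andP[? /(allP s_ge)]; lia.
    split; first by apply/mapP => -[x /f_ge]; lia.
      by rewrite -sz_s -sum_s sumE; lia.
    (* Truncated subtraction of [k] is injective on the remaining parts because they all exceed
       [k]. *)
    rewrite map_inj_in_uniq ?s_uniq => [|x y /f_ge + /f_ge]; last by lia.
    by apply/eqP; lia.
  move=> s t _ _ /andP[/and3P[/andP[_ s_ge] /eqP s_k _] _].
  move=> /andP[/and3P[/andP[_ t_ge] /eqP t_k _] _] st.
  rewrite (permPl (fK s s_ge s_k)) (permPr (fK t t_ge t_k)) perm_cat2r.
  exact: perm_map.
apply: (@leq_num_partitions _ _ _ _ (fun s => map (addn k) s ++ nseq k k)).
- move=> s t st; rewrite /smallest_part (perm_mem st) (perm_all _ st).
  by rewrite (permP st) (perm_uniq (perm_filter _ st)) (perm_size st).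
- move=> s /and3P[_ s_gt0 /eqP sum_s] /andP[s_uniq /eqP sz_s].
  have Nk : k \notin map (addn k) s.
    by apply: contra s_gt0 => /mapP[x xs xE]; rewrite (_ : 0 = x) //; lia.
  split.
  + rewrite mem_cat negb_or mem_nseq; apply/andP; split; last by lia.
    by apply/mapP => -[x _]; lia.
  + by rewrite sumn_cat sum_addk sumn_nseq sum_s sz_s; nia.
  rewrite /smallest_part mem_cat mem_nseq k_gt0 eqxx orbT all_cat all_nseq leqnn.
  rewrite orbT andbT count_cat (count_memPn Nk) count_nseq /= eqxx mul1n eqxx.
  rewrite filter_cat cat_uniq size_cat size_map size_nseq sz_s subnK // eqxx.
  rewrite filter_nseq eqxx /= !andbT filter_uniq ?andbT.
    by apply/allP => _ /mapP[x _ ->]; apply: leq_addr.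
  by rewrite map_inj_uniq //; apply: addnI.
move=> s t _ _ _ _; rewrite perm_cat2r.
by apply: perm_map_inj; apply: addnI.
Qed.

(** For [k = 0] the guard always holds and the term is [num_distinct m n], so the separate clause
    defining [P 0 n] fits the same formula. *)
Lemma P_sum_size k n :
  P k n = \sum_(m < n.+1)
    if (k <= m) && (k * m <= n) then num_distinct (m - k) (n - k * m) else 0.
Proof.
rewrite /P; case: k => [|k]; rewrite num_partitions_size.
  by apply: eq_bigr => m _; rewrite !subn0.
by apply: eq_bigr => m _; rewrite P_size_term.
Qed.

Local Open Scope ring_scope.

Lemma num_distinct_avoidingE m l n : (0 < m)%N ->
  (num_distinct_avoiding m l n)%:Z =
  \sum_(k < l.+1) (-1) ^+ k *
    (if k * m <= n then num_distinct (l - k) (n - k * m) else 0)%N%:Z.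
Proof.
move=> m_gt0; elim: l n => [|l IHl] n.
  rewrite big_ord1 /= expr0 mul1r mul0n !subn0; congr Posz.
  by apply: eq_num_partitions => -[|x s]; rewrite ?andbF.
rewrite big_ord_recl /= expr0 mul1r mul0n !subn0.
(* Split the [k = 0] term according to whether [m] is a part. *)
have -> : (num_distinct l.+1 n)%:Z = (num_distinct_avoiding m l.+1 n)%:Z
    + (if m <= n then num_distinct_avoiding m l (n - m) else 0)%N%:Z.
  rewrite -num_distinct_mem // -PoszD; congr Posz.
  rewrite /num_distinct (num_partitionsID _ _ (fun s => m \in s)) addnC.
  by congr (_ + _)%N; apply: eq_num_partitions => s _; rewrite andbA.
rewrite -[LHS]addr0 -addrA; congr (_ + _).
case: leqP => [le_mn | lt_nm]; last first.
  rewrite big1 // => k _; rewrite ifN ?mulr0 //.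
  by rewrite /bump /= add1n mulSn; lia.
(* Term [k] of the induction hypothesis at [n - m] cancels term [k + 1] of the sum, which has the
   opposite sign. *)
rewrite IHl -big_split big1 // => k _ /=.
rewrite /bump /= add1n exprS mulSn subSS subnDA leq_subRL //.
ring.
Qed.

(** Once the size is fixed to [m], the non-Rascoe condition forbids one fixed part, [m]. *)
Lemma b_sum_size n :
  b n = (\sum_(m < n.+1) num_distinct_avoiding m m n)%N.
Proof.
rewrite /b num_partitions_size; apply: eq_bigr => m _.
apply: eq_num_partitions => s _; rewrite /non_Rascoe -andbA.
by case: eqVneq => [-> | _]; rewrite ?andbT ?andbF.
Qed.

Theorem theorem1p4 (n : nat) :
  \sum_(0 <= j < n.+1) (-1) ^+ j * (P j n)%:Z = (b n)%:Z.
Proof.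
pose F (k m : nat) := (-1) ^+ k * (if (k <= m) && (k * m <= n)
  then num_distinct (m - k) (n - k * m) else 0)%N%:Z.
rewrite big_mkord b_sum_size.
transitivity (\sum_(k < n.+1) \sum_(m < n.+1) F k m).
  apply: eq_bigr => k _; rewrite P_sum_size -mulr_sumr; congr (_ * _).
  exact: (big_morph Posz PoszD).
rewrite exchange_big (big_morph Posz PoszD (erefl _)); apply: eq_bigr => m _ /=.
have -> : \sum_(k < n.+1) F k m = \sum_(k < m.+1) F k m.
  rewrite [RHS](big_ord_widen_cond n.+1 xpredT (F^~ m)) //= [RHS]big_mkcond /=.
  apply: eq_bigr => k _; rewrite /F ltnS.
  by case: (leqP k m) => //= _; rewrite mulr0.
(* The expansion requires [m > 0]. At [m = 0] only [k = 0] remains, and avoiding 0 is automatic for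
   a partition. *)
case: (posnP m) => [-> | m_gt0].
  rewrite big_ord1 /F expr0 mul1r !subn0 /=; congr Posz.
  by apply: eq_num_partitions => s /and3P[_ -> _]; rewrite andbT.
rewrite num_distinct_avoidingE //; apply: eq_bigr => k _.
by rewrite /F -ltnS ltn_ord.
Qed.
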